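(* Let $S$ be a set with a ternary operation $[\ ]$. Then $[\ ]$ is the standard ternary operation of an inverse semigroup on $S$ (i.e. there is a binary operation on $S$ making $S$ an inverse semigroup such that $[xyz]=xy^{-1}z$ for all $x,y,z\in S$) if and only if $(S,[\ ])$ is a generalised heap and there exist an involutive unary mapping ${}':x\mapsto x'$ on $S$ and an idempotent unary mapping ${}^\wedge:x\mapsto x^\wedge$ on $S$ such that the following identities hold for all $x,y\in S$: (1) $[x\,x^\wedge\,y]=[x\,y'\,y^\wedge]$; (2) $[x^\wedge\,x^\wedge\,x']=x'$; (3) $[x'\,x'\,x^\wedge]=x^\wedge$.
   Context: A set $S$ with a ternary operation $[\ ]$ is a semiheap if $[[xyz]uv]=[x[uzy]v]=[xy[zuv]]$ for all $x,y,z,u,v\in S$. A semiheap is a generalised heap if it is idempotent, i.e. $[xxx]=x$ for all $x$, and satisfies the identities $[xx[yyz]]=[yy[xxz]]$ and $[[xyy]zz]=[[xzz]yy]$. A unary mapping ${}'$ is involutive if $(x')'=x$ for all $x$; a unary mapping ${}^\wedge$ is idempotent if $(x^\wedge)^\wedge=x^\wedge$ for all $x$. *)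

(* Defs.v *)
From mathcomp Require Import ssreflect ssrfun ssrbool.

Set Implicit Arguments.
Unset Strict Implicit.
Unset Printing Implicit Defensive.

Definition semiheap (S : Type) (t : S -> S -> S -> S) : Prop :=
  forall x y z u v : S,
    t (t x y z) u v = t x (t u z y) v /\ t x (t u z y) v = t x y (t z u v).

Definition generalised_heap (S : Type) (t : S -> S -> S -> S) : Prop :=
  [/\ semiheap t,
      forall x : S, t x x x = x,
      forall x y z : S, t x x (t y y z) = t y y (t x x z)
    & forall x y z : S, t (t x y y) z z = t (t x z z) y y].

Definition inverse_of (S : Type) (mul : S -> S -> S) (x y : S) : Prop :=
  mul (mul x y) x = x /\ mul (mul y x) y = y.

Definition inverse_semigroup (S : Type) (mul : S -> S -> S) : Prop :=
  associative mul /\ forall x : S, exists! y : S, inverse_of mul x y.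

(* In an inverse semigroup, the first condition on [inv] determines it: [inv] is
   the map sending each element to its unique inverse. *)
Definition standard_ternary (S : Type) (mul : S -> S -> S)
    (t : S -> S -> S -> S) : Prop :=
  exists inv : S -> S,
    (forall x : S, inverse_of mul x (inv x)) /\
    (forall x y z : S, t x y z = mul (mul x (inv y)) z).

(* Main.v *)
Require Import Defs.
From mathcomp Require Import ssreflect ssrfun ssrbool.

(** For an inverse semigroup take [x' = x^-1] and [x^ = x^-1 x]. Conversely,
    put [x * y = [x x^ y]], which by (1) is also [[x y' y^]]; writing a triple
    product with one form on each side makes associativity an instance of the
    semiheap law. By (2) and (3), [x * x'] is [(x')^] and [x'] is an inverse of
    [x], and [[x y z] = x * y' * z]. The two generalised heap identities say that
    the elements [x * x'] commute when multiplied on the right by a further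
    element, and the elements [x' * x] when multiplied on the left; as [x'' = x]
    these are the same elements, so they commute, hence all idempotents commute
    and inverses are unique. *)

Section CommutingIdempotents.

Variables (S : Type) (mul : S -> S -> S).
Local Infix "*" := mul.
Hypothesis mulA : associative mul.

Definition idempotents_commute : Prop :=
  forall e f : S, e * e = e -> f * f = f -> e * f = f * e.

Lemma inverse_of_sym x y : inverse_of mul x y -> inverse_of mul y x.
Proof. by case. Qed.

Lemma inverse_of_idempl x y : inverse_of mul x y -> (x * y) * (x * y) = x * y.
Proof. by case=> xyx _; rewrite mulA xyx. Qed.

Lemma inverse_of_idempr x y : inverse_of mul x y -> (y * x) * (y * x) = y * x.
Proof. by case=> _ yxy; rewrite mulA yxy. Qed.

Lemma inverse_of_idem e : e * e = e -> inverse_of mul e e.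
Proof. by move=> ee; split; rewrite !ee. Qed.

(** Commuting [x * y] with [x * z] gives [y = y * x * z]; commuting [y * x] with [z * x] gives
    [y * x * z = z]. *)
Lemma commuting_inverse_unique x y z :
  idempotents_commute -> inverse_of mul x y -> inverse_of mul x z -> y = z.
Proof.
move=> comm xy xz.
have [[xyx yxy] [xzx zxz]] := (xy, xz).
have yE : y = y * x * z.
  rewrite -{1}yxy -{1}xzx -!mulA (mulA x z) (comm _ (x * y)).
  - by rewrite !mulA yxy.
  - exact: inverse_of_idempl.
  - exact: inverse_of_idempl.
rewrite yE -{1}zxz !mulA -(mulA (y * x)) (comm _ (z * x)).
- by rewrite -!mulA (mulA x y) (mulA (x * y)) xyx mulA.
- exact: inverse_of_idempr.
- exact: inverse_of_idempr.
Qed.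

(** If [x] is the inverse of [e * f], then [f * x * e] is another one, so [x = f * x * e], which
    forces [x] to be idempotent. Then [x] is its own inverse and [e * f = x] is idempotent. *)
Lemma inverse_semigroup_idempotents_commute :
  inverse_semigroup mul -> idempotents_commute.
Proof.
move=> [_ invP].
have uniq x y z : inverse_of mul x y -> inverse_of mul x z -> y = z.
  by have [w [_ wP]] := invP x => /wP <- /wP <-.
have idemM e f : e * e = e -> f * f = f -> (e * f) * (e * f) = e * f.
  move=> ee ff; have [x [xP _]] := invP (e * f).
  have [efx xef] := xP.
  have xE : x = f * x * e.
    apply: uniq xP _; split.
      by rewrite !mulA -(mulA e f f) ff -(mulA _ e e) ee -[RHS]efx !mulA.
    rewrite -!mulA (mulA e e) ee (mulA f f) ff.
    by rewrite (mulA e f) (mulA x (e * f)) (mulA _ x e) xef.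
  have xx : x * x = x.
    transitivity (f * (x * (e * f) * x) * e); last by rewrite xef -xE.
    by rewrite {1 2}xE !mulA.
  have -> // : e * f = x.
  by apply: (uniq x); [exact: inverse_of_sym | exact: inverse_of_idem].
move=> e f ee ff.
have efef := idemM _ _ ee ff; have fefe := idemM _ _ ff ee.
(* The idempotent [e * f] has both itself and [f * e] as inverses. *)
apply: (uniq (e * f)); first exact: inverse_of_idem.
split.
  by rewrite !mulA -(mulA e f f) ff -(mulA _ e e) ee -mulA efef.
by rewrite !mulA -(mulA f e e) ee -(mulA _ f f) ff -mulA fefe.
Qed.

Variable inv : S -> S.
Hypothesis invP : forall x, inverse_of mul x (inv x).

Lemma inv_involutive : idempotents_commute -> involutive inv.
Proof.
move=> comm x; apply: (commuting_inverse_unique (inv x)) => //.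
exact: inverse_of_sym.
Qed.

(** Commuting [inv x * x] with [y * inv y] shows that [inv y * inv x] is an inverse of [x * y]. *)
Lemma inv_mul x y : idempotents_commute -> inv (x * y) = inv y * inv x.
Proof.
move=> comm; apply: (commuting_inverse_unique (x * y)) => //.
have xVx := inverse_of_idempr _ _ (invP x).
have yyV := inverse_of_idempl _ _ (invP y).
have [[xx Vx] [yy Vy]] := (invP x, invP y).
split.
  rewrite !mulA -(mulA x y) -(mulA _ _ x) -(mulA x) (comm _ _ yyV xVx).
  by rewrite !mulA xx -!mulA (mulA y) yy.
rewrite !mulA -(mulA (inv y) (inv x)) -(mulA _ y) -(mulA (inv y)).
by rewrite (comm _ _ xVx yyV) !mulA Vy -!mulA (mulA (inv x)) Vx.
Qed.

Lemma projections_commute_idempotents_commute :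
  (forall x y, (x * inv x) * (y * inv y) = (y * inv y) * (x * inv x)) ->
  involutive inv -> idempotents_commute.
Proof.
move=> comm invK.
suff proj e : e * e = e -> e * inv e = e.
  by move=> e f /proj <- /proj <-.
move=> ee; have [eVe VeV] := invP e.
(* As [e] is idempotent, [inv e] is [(inv e * e) * (e * inv e)]; swapping these projections puts [e]
   at both ends, so [inv e] absorbs [e] on either side. *)
have Ve : inv e = (e * inv e) * (inv e * e).
  have := comm e (inv e); rewrite invK => ->.
  by rewrite !mulA -(mulA (inv e) e e) ee VeV.
have eV : e * inv e = inv e by rewrite {1}Ve !mulA ee [RHS]Ve !mulA.
have Vee : inv e * e = inv e by rewrite {1}Ve -!mulA ee [RHS]Ve !mulA.
by rewrite eV -[RHS]eVe eV Vee.
Qed.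

Lemma inverse_semigroup_inv :
  idempotents_commute -> inverse_semigroup mul.
Proof.
move=> comm; split=> // x; exists (inv x); split=> // y.
exact: commuting_inverse_unique.
Qed.

End CommutingIdempotents.

Lemma inverse_semigroup_generalised_heap (S : Type) (mul : S -> S -> S)
    (t : S -> S -> S -> S) :
  inverse_semigroup mul -> standard_ternary mul t -> generalised_heap t.
Proof.
move=> isg [inv [invP tE]]; have [mulA _] := isg.
have comm := inverse_semigroup_idempotents_commute _ _ mulA isg.
have invK := inv_involutive _ _ mulA inv invP comm.
have invM x y := inv_mul _ _ mulA inv invP x y comm.
split.
- by move=> x y z u v; rewrite !tE !invM invK !mulA.
- by move=> x; rewrite tE; case: (invP x).
- move=> x y z; rewrite !tE !mulA; congr mul.
  rewrite -!(mulA _ y) -!(mulA _ x).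
  by apply: comm; exact: inverse_of_idempl.
- move=> x y z; rewrite !tE -!mulA; congr mul.
  rewrite !mulA -!(mulA _ _ z) -!(mulA _ _ y).
  by apply: comm; exact: inverse_of_idempr.
Qed.

Section ProductOfTernary.

Variables (S : Type) (t : S -> S -> S -> S) (prime hat : S -> S).
Hypothesis heap : generalised_heap t.
Hypothesis primeK : involutive prime.
Hypothesis hatK : forall x, hat (hat x) = hat x.
Hypothesis hat_prime : forall x y, t x (hat x) y = t x (prime y) (hat y).
Hypothesis hat_range : forall x, t (hat x) (hat x) (prime x) = prime x.
Hypothesis prime_range : forall x, t (prime x) (prime x) (hat x) = hat x.

(** With [hat x] read as x^-1 x, which is its own inverse, this is x x^-1 x y = xy. *)
Definition ternary_mul (x y : S) : S := t x (hat x) y.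
Local Infix "*" := ternary_mul.

Lemma semiheapA x y z u v : t (t x y z) u v = t x y (t z u v).
Proof. by have [/(_ x y z u v) [-> ->]] := heap. Qed.

Lemma semiheapM x y z u v : t (t x y z) u v = t x (t u z y) v.
Proof. by have [/(_ x y z u v) [->]] := heap. Qed.

Lemma ternary_mulA : associative ternary_mul.
Proof.
move=> x y z.
by rewrite /ternary_mul (hat_prime y) (hat_prime (t _ _ _)) semiheapA.
Qed.

Lemma ternary_mul_prime x : x * prime x = hat (prime x).
Proof.
by rewrite /ternary_mul hat_prime -{2}(prime_range (prime x)) !primeK.
Qed.

Lemma ternary_prime_mul x : prime x * x = hat x.
Proof. by have := ternary_mul_prime (prime x); rewrite primeK. Qed.

Lemma ternary_hat_mul x : hat (prime x) * x = x.
Proof. by have := hat_range (prime x); rewrite /ternary_mul hatK primeK. Qed.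

Lemma ternary_inverse x : inverse_of ternary_mul x (prime x).
Proof.
split; first by rewrite ternary_mul_prime ternary_hat_mul.
by rewrite ternary_prime_mul; have := ternary_hat_mul (prime x); rewrite primeK.
Qed.

Lemma ternaryE x y z : t x y z = x * prime y * z.
Proof.
have -> : x * prime y = t x y (hat (prime y)).
  by rewrite /ternary_mul hat_prime primeK.
(* Passing to the form with [prime z] and [hat z] lets the product with [z] be reassociated inside
   the triple. *)
rewrite {1}/ternary_mul hat_prime semiheapA -hat_prime.
have -> : t (hat (prime y)) (hat (hat (prime y))) z
        = t (hat (prime y)) (hat (prime y)) z by rewrite hatK.
(* The middle semiheap law carries both copies of [hat (prime y)] next to [y], where [hat_range]
   absorbs them. *)
rewrite -semiheapA semiheapM.
by have := hat_range (prime y); rewrite primeK => ->.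
Qed.

Lemma ternary_projections_commute x y :
  (x * prime x) * (y * prime y) = (y * prime y) * (x * prime x).
Proof.
have mulA := ternary_mulA.
have [_ _ heapl heapr] := heap.
set p := x * prime x; set q := y * prime y.
have qq : q * q = q := inverse_of_idempl _ _ mulA _ _ (ternary_inverse y).
have pql z : p * q * z = q * p * z.
  by have := heapl x y z; rewrite !ternaryE !mulA -/p -/q.
have pqr z : z * p * q = z * q * p.
  (* The primed arguments turn the right-hand pairs into [x * prime x] and [y * prime y]. *)
  have := heapr z (prime x) (prime y).
  by rewrite !ternaryE !primeK -!mulA -/p -/q.
(* The spare factor is taken to be [q]: pq = pqq = qpq = qqp = qp. *)
by rewrite -[in LHS]qq mulA pql pqr qq.
Qed.

End ProductOfTernary.

Theorem theorem89 (S : Type) (t : S -> S -> S -> S) :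
  (exists mul : S -> S -> S, inverse_semigroup mul /\ standard_ternary mul t)
  <->
  (generalised_heap t /\
   exists prime hat : S -> S,
     involutive prime /\
     idempotent_fun hat /\
     (forall x y : S, t x (hat x) y = t x (prime y) (hat y)) /\
     (forall x : S, t (hat x) (hat x) (prime x) = prime x) /\
     (forall x : S, t (prime x) (prime x) (hat x) = hat x)).
Proof.
split=> [[mul [isg std]] | [heap [prime [hat [primeK [hatK [hp [hr pr]]]]]]]].
  split; first exact: inverse_semigroup_generalised_heap isg std.
  have [inv [invP tE]] := std; have [mulA _] := isg.
  have comm := inverse_semigroup_idempotents_commute _ _ mulA isg.
  have invK := inv_involutive _ _ mulA inv invP comm.
  have invM x y := inv_mul _ _ mulA inv invP x y comm.
  have xVx x := proj1 (invP x); have VxV x := proj2 (invP x).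
  exists inv, (fun x => mul (inv x) x).
  split; first exact: invK.
  split; first by move=> x /=; rewrite invM invK mulA VxV.
  split.
    (* Both sides of (1) equal the product xy. *)
    by move=> x y; rewrite !tE invM !invK !mulA xVx -{1}(xVx y) !mulA.
  by split=> x; rewrite tE ?invM !invK !mulA ?VxV.
have mulA := ternary_mulA _ _ _ _ heap hp.
have invP := ternary_inverse _ _ _ _ primeK hatK hp hr pr.
exists (ternary_mul S t hat); split.
  apply: (inverse_semigroup_inv _ _ mulA _ invP).
  apply: (projections_commute_idempotents_commute _ _ mulA _ invP) => // x y.
  exact: ternary_projections_commute.
exists prime; split=> // x y z.
exact: ternaryE.
Qed.
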